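(* Let $\mathfrak g$ be the real linear span of the five matrices of any one of the following three families (for any real values of the parameters). Then every integral variety of type $(1/2,0)$ related to $\mathfrak g$ is affinely equivalent to (an open piece of) the quadric $v = 2x_1^2+|z_2|^2$. Family A (parameters $m_1,m_2,t_{16}\in\mathbb{R}$, $m_2\ne0$): $E_1=\begin{pmatrix} m_1&0&0&1\\0&m_1+\frac{i m_1 t_{16}}{m_2}&0&0\\4i&0&2m_1&0\\0&0&0&0\end{pmatrix}$, $E_2=\begin{pmatrix} m_2&0&0&i\\0&m_2+it_{16}&0&0\\0&0&2m_2&0\\0&0&0&0\end{pmatrix}$, $E_3=\begin{pmatrix}0&0&0&0\\0&0&0&1\\0&2i&0&0\\0&0&0&0\end{pmatrix}$, $E_4=\begin{pmatrix}0&0&0&0\\0&0&0&i\\0&2&0&0\\0&0&0&0\end{pmatrix}$, $E_5=\begin{pmatrix}0&0&0&0\\0&0&0&0\\0&0&0&1\\0&0&0&0\end{pmatrix}$. Family B (parameters $m_1,m_3,m_4\in\mathbb{R}$): $E_1=\begin{pmatrix} -2m_1&0&im_1^2&1\\0&0&0&0\\4i&0&2m_1&0\\0&0&0&0\end{pmatrix}$, $E_2=\begin{pmatrix}0&0&0&i\\0&0&0&0\\0&0&0&0\\0&0&0&0\end{pmatrix}$, $E_3=\begin{pmatrix} m_3&-m_1&\frac{i}{2}m_1m_3&0\\0&m_3-im_4&0&1\\0&2i&2m_3&0\\0&0&0&0\end{pmatrix}$, $E_4=\begin{pmatrix} m_4&im_1&\frac{i}{2}m_1m_4&0\\0&m_4+im_3&0&i\\0&2&2m_4&0\\0&0&0&0\end{pmatrix}$,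 $E_5=\begin{pmatrix}0&0&0&0\\0&0&0&0\\0&0&0&1\\0&0&0&0\end{pmatrix}$. Family C (parameters $m_1,m_2,m_3,m_4,t_7\in\mathbb{R}$): $E_1=\begin{pmatrix} 3t_7-2m_1&0&\frac{i}{2}(2m_1-t_7)(m_1-t_7)&1\\0&t_7&0&0\\4i&0&2m_1&0\\0&0&0&0\end{pmatrix}$, $E_2=\begin{pmatrix} m_2&0&\frac{i}{2}m_2(m_1-t_7)&i\\0&m_2&0&0\\0&0&2m_2&0\\0&0&0&0\end{pmatrix}$, $E_3=\begin{pmatrix} m_3&t_7-m_1&\frac{i}{2}m_3(m_1-t_7)&0\\0&m_3&0&1\\0&2i&2m_3&0\\0&0&0&0\end{pmatrix}$, $E_4=\begin{pmatrix} m_4&i(m_1-t_7)&\frac{i}{2}m_4(m_1-t_7)&0\\0&m_4&0&i\\0&2&2m_4&0\\0&0&0&0\end{pmatrix}$, $E_5=\begin{pmatrix} -\frac12 m_2(m_1-t_7)&0&-\frac{i}{4}m_2(m_1-t_7)^2&0\\0&-\frac12 m_2(m_1-t_7)&0&0\\0&0&-m_2(m_1-t_7)&1\\0&0&0&0\end{pmatrix}$.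
   Context: Coordinates in $\mathbb{C}^3$ are $z_1=x_1+iy_1$, $z_2=x_2+iy_2$, $w=u+iv$, $z=(z_1,z_2)$. To a complex $4\times4$ matrix $\begin{pmatrix}a_1&a_2&a_3&p\\ b_1&b_2&b_3&s\\ c_1&c_2&c_3&q\\0&0&0&0\end{pmatrix}$ one associates the holomorphic affine vector field $Z=(a_1z_1+a_2z_2+a_3w+p)\frac{\partial}{\partial z_1}+(b_1z_1+b_2z_2+b_3w+s)\frac{\partial}{\partial z_2}+(c_1z_1+c_2z_2+c_3w+q)\frac{\partial}{\partial w}$. For a real linear span $\mathfrak g$ of such matrices, an integral variety of type $(1/2,0)$ related to $\mathfrak g$ is a real-analytic strictly pseudoconvex real hypersurface $M$ defined near $0\in\mathbb{C}^3$, with $0\in M$, given near $0$ by an equation $v=|z_1|^2+|z_2|^2+\frac12(z_1^2+\bar z_1^2)+\sum_{k+l+2m\ge 3}F_{klm}(z,\bar z)u^m$ (with $F_{klm}$ a polynomial of degree $k$ in $z$ and $l$ in $\bar z$, the right-hand side real), such that for every $Z\in\mathfrak g$ the real vector field $Z+\bar Z$ is tangent to $M$, i.e. $\mathrm{Re}(Z(\Phi))|_M=0$ for a defining function $\Phi$ of $M$. Two hypersurfaces are affinely equivalent if a complex affine transformation of $\mathbb{C}^3$ maps a neighbourhood in one onto an open piece of the other. *)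

(* Defs.v *)
From HB Require Import structures.
From mathcomp Require Import all_boot all_order all_algebra.
From mathcomp Require Import all_classical all_reals all_analysis.
From mathcomp Require Import complex.
Set Implicit Arguments. Unset Strict Implicit. Unset Printing Implicit Defensive.
Import Order.TTheory GRing.Theory Num.Theory.
Local Open Scope classical_set_scope.
Local Open Scope ring_scope.

Section Defs.
Variable R : realType.
Local Notation C := (R[i]).

Definition z1 (p : 'rV[C]_3) : C := p 0 (inord 0).
Definition z2 (p : 'rV[C]_3) : C := p 0 (inord 1).
Definition w  (p : 'rV[C]_3) : C := p 0 (inord 2).

Definition mx4 (l : seq (seq C)) : 'M[C]_4 :=
  \matrix_(i < 4, j < 4) nth 0 (nth [::] l i) j.

Definition vfield (N : 'M[C]_4) (p : 'rV[C]_3) : 'rV[C]_3 :=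
  \row_(j < 3) (\sum_(k < 3) N (inord j) (inord k) * p 0 k + N (inord j) (inord 3)).

Definition real_span (s : seq 'M[C]_4) (N : 'M[C]_4) : Prop :=
  exists lam : nat -> R, N = \sum_(k < size s) ((lam k)%:C)%C *: nth 0 s k.

Definition rsum (T : choiceType) (f : T -> R) : R :=
  fine (\esum_(a in [set: T]) ((f^\+) a)%:E) - fine (\esum_(a in [set: T]) ((f^\-) a)%:E).

Definition midx := (nat * nat * nat * nat * nat)%type.

Definition mono (x1 y1 x2 y2 u : R) (a : midx) : R :=
  let: (a1, b1, a2, b2, e) := a in
  x1 ^+ a1 * y1 ^+ b1 * x2 ^+ a2 * y2 ^+ b2 * u ^+ e.

Definition wdeg (a : midx) : nat :=
  let: (a1, b1, a2, b2, e) := a in (a1 + b1 + a2 + b2 + 2 * e)%N.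

(* coefficients of |z1|^2 + |z2|^2 + 1/2 (z1^2 + zbar1^2) = 2 x1^2 + x2^2 + y2^2 *)
Definition quad_coef (a : midx) : R :=
  if a == (2, 0, 0, 0, 0)%N then 2
  else if a == (0, 0, 2, 0, 0)%N then 1
  else if a == (0, 0, 0, 2, 0)%N then 1
  else 0.

Definition in_box (r x1 y1 x2 y2 u : R) : Prop :=
  [/\ `|x1| < r, `|y1| < r, `|x2| < r, `|y2| < r & `|u| < r].

Definition pser (c : midx -> R) (x1 y1 x2 y2 u : R) : R :=
  rsum (fun a => c a * mono x1 y1 x2 y2 u a).

(* The data (r, c) define a real-analytic function F (a power series absolutely
   convergent on the box of radius r) of the required form
   F = |z1|^2+|z2|^2+1/2(z1^2+zbar1^2) + (terms of weighted degree >= 3). *)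
Definition normal_form_data (r : R) (c : midx -> R) : Prop :=
  [/\ 0 < r,
      (forall x1 y1 x2 y2 u, in_box r x1 y1 x2 y2 u ->
         summable [set: midx] (fun a => (c a * mono x1 y1 x2 y2 u a)%:E))
    & (forall a, (wdeg a <= 2)%N -> c a = quad_coef a)].

Definition Fval (c : midx -> R) (p : 'rV[C]_3) : R :=
  pser c (complex.Re (z1 p)) (complex.Im (z1 p)) (complex.Re (z2 p))
         (complex.Im (z2 p)) (complex.Re (w p)).

Definition Phi (c : midx -> R) (p : 'rV[C]_3) : R := Fval c p - complex.Im (w p).

Definition hyps (r : R) (c : midx -> R) : set 'rV[C]_3 :=
  [set p | in_box r (complex.Re (z1 p)) (complex.Im (z1 p)) (complex.Re (z2 p))
                    (complex.Im (z2 p)) (complex.Re (w p))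
           /\ complex.Im (w p) = Fval c p].

(* The real vector field Z + Zbar is tangent to M: at each point p of M the
   derivative of Phi along the real direction of Z(p) vanishes, i.e.
   Re (Z Phi) = 0 on M. *)
Definition tangent_to (N : 'M[C]_4) (r : R) (c : midx -> R) : Prop :=
  forall p, hyps r c p ->
    derive1 (fun t : R => Phi c (p + ((t%:C)%C) *: vfield N p)) 0 = 0.

Definition integral_variety_12 (s : seq 'M[C]_4) (r : R) (c : midx -> R) : Prop :=
  normal_form_data r c /\ forall N, real_span s N -> tangent_to N r c.

Definition copen (W : set 'rV[C]_3) : Prop :=
  forall p, W p -> exists e : R, 0 < e /\
    forall q : 'rV[C]_3, (forall j, `|complex.Re (q 0 j - p 0 j)| < e /\
                                   `|complex.Im (q 0 j - p 0 j)| < e) -> W q.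

Definition quadric : set 'rV[C]_3 :=
  [set p | complex.Im (w p) = 2 * complex.Re (z1 p) ^+ 2
             + complex.Re (z2 p) ^+ 2 + complex.Im (z2 p) ^+ 2].

Definition affinely_equiv_quadric (M : set 'rV[C]_3) : Prop :=
  exists (L : 'M[C]_3) (b : 'rV[C]_3), L \in unitmx /\
    exists V W : set 'rV[C]_3, [/\ copen V, V 0, copen W &
      (fun p => p *m L + b) @` (M `&` V) = quadric `&` W].

Local Open Scope complex_scope.
Local Notation "x %:C" := (real_complex R x).
Local Notation I := ('i : C).

Definition familyA (m1 m2 t16 : R) : seq 'M[C]_4 :=
  [:: mx4 [:: [:: m1%:C; 0; 0; 1];
              [:: 0; m1%:C + I * m1%:C * t16%:C / m2%:C; 0; 0];
              [:: 4%:C * I; 0; 2%:C * m1%:C; 0];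
              [:: 0; 0; 0; 0]];
      mx4 [:: [:: m2%:C; 0; 0; I];
              [:: 0; m2%:C + I * t16%:C; 0; 0];
              [:: 0; 0; 2%:C * m2%:C; 0];
              [:: 0; 0; 0; 0]];
      mx4 [:: [:: 0; 0; 0; 0];
              [:: 0; 0; 0; 1];
              [:: 0; 2%:C * I; 0; 0];
              [:: 0; 0; 0; 0]];
      mx4 [:: [:: 0; 0; 0; 0];
              [:: 0; 0; 0; I];
              [:: 0; 2%:C; 0; 0];
              [:: 0; 0; 0; 0]];
      mx4 [:: [:: 0; 0; 0; 0];
              [:: 0; 0; 0; 0];
              [:: 0; 0; 0; 1];
              [:: 0; 0; 0; 0]]].

Definition familyB (m1 m3 m4 : R) : seq 'M[C]_4 :=
  [:: mx4 [:: [:: - (2%:C * m1%:C); 0; I * m1%:C ^+ 2; 1];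
              [:: 0; 0; 0; 0];
              [:: 4%:C * I; 0; 2%:C * m1%:C; 0];
              [:: 0; 0; 0; 0]];
      mx4 [:: [:: 0; 0; 0; I];
              [:: 0; 0; 0; 0];
              [:: 0; 0; 0; 0];
              [:: 0; 0; 0; 0]];
      mx4 [:: [:: m3%:C; - m1%:C; I / 2%:C * m1%:C * m3%:C; 0];
              [:: 0; m3%:C - I * m4%:C; 0; 1];
              [:: 0; 2%:C * I; 2%:C * m3%:C; 0];
              [:: 0; 0; 0; 0]];
      mx4 [:: [:: m4%:C; I * m1%:C; I / 2%:C * m1%:C * m4%:C; 0];
              [:: 0; m4%:C + I * m3%:C; 0; I];
              [:: 0; 2%:C; 2%:C * m4%:C; 0];
              [:: 0; 0; 0; 0]];
      mx4 [:: [:: 0; 0; 0; 0];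
              [:: 0; 0; 0; 0];
              [:: 0; 0; 0; 1];
              [:: 0; 0; 0; 0]]].

Definition familyC (m1 m2 m3 m4 t7 : R) : seq 'M[C]_4 :=
  let d := m1%:C - t7%:C in
  [:: mx4 [:: [:: 3%:C * t7%:C - 2%:C * m1%:C; 0;
                  I / 2%:C * (2%:C * m1%:C - t7%:C) * d; 1];
              [:: 0; t7%:C; 0; 0];
              [:: 4%:C * I; 0; 2%:C * m1%:C; 0];
              [:: 0; 0; 0; 0]];
      mx4 [:: [:: m2%:C; 0; I / 2%:C * m2%:C * d; I];
              [:: 0; m2%:C; 0; 0];
              [:: 0; 0; 2%:C * m2%:C; 0];
              [:: 0; 0; 0; 0]];
      mx4 [:: [:: m3%:C; t7%:C - m1%:C; I / 2%:C * m3%:C * d; 0];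
              [:: 0; m3%:C; 0; 1];
              [:: 0; 2%:C * I; 2%:C * m3%:C; 0];
              [:: 0; 0; 0; 0]];
      mx4 [:: [:: m4%:C; I * d; I / 2%:C * m4%:C * d; 0];
              [:: 0; m4%:C; 0; I];
              [:: 0; 2%:C; 2%:C * m4%:C; 0];
              [:: 0; 0; 0; 0]];
      mx4 [:: [:: - (1%:C / 2%:C * m2%:C * d); 0; - (I / 4%:C * m2%:C * d ^+ 2); 0];
              [:: 0; - (1%:C / 2%:C * m2%:C * d); 0; 0];
              [:: 0; 0; - (m2%:C * d); 1];
              [:: 0; 0; 0; 0]]].

End Defs.

(* Main.v *)
(** For every family there is a real [a] (namely [0], [m1 / 2] and [(m1 - t7) / 2]
    for A, B and C) such that each of the five fields [E_k] satisfies
    [E_k Psi = lam_k Psi] with [Psi = v - 2 (x1 + a v)^2 - |z2|^2] and [lam_k] real.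
    Hence the restriction [g] of [Psi] to [M], written in the graph coordinates
    [(x1, y1, x2, y2, u)], satisfies [X_k g = lam_k g] for the projections [X_k] of
    the [E_k]; these are close to the coordinate fields near the origin, so
    [|grad g| <= C |g|], and [g 0 = 0] forces [g = 0] near the origin.  Thus [M] is
    the germ of [Psi = 0], which the shear [z1 |-> z1 - i a w] maps to the quadric.
    Only the differentiability of the power series defining [M] is needed. *)

Require Import Defs.
From HB Require Import structures.
From mathcomp Require Import all_boot all_order all_algebra.
From mathcomp Require Import all_classical all_reals all_analysis.
From mathcomp Require Import complex.
From mathcomp Require Import ring lra zify.
Import Order.TTheory GRing.Theory Num.Theory.
Import numFieldNormedType.Exports.
Local Open Scope classical_set_scope.
Local Open Scope ring_scope.

(** * Linearity and monotonicity of absolutely convergent sums over an arbitrary index type *)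

Section UnconditionalSums.
Set Implicit Arguments. Unset Strict Implicit.
Context {R : realType} {T : choiceType}.
Implicit Types f g p q : T -> R.

Definition abs_summable f := summable [set: T] (EFin \o f).

Lemma abs_summable_le f g :
  abs_summable g -> (forall a, `|f a| <= `|g a|) -> abs_summable f.
Proof.
move=> sg fg; apply: le_lt_trans sg.
by apply: le_esum => a _; rewrite /= lee_fin fg.
Qed.

Lemma abs_summableD f g :
  abs_summable f -> abs_summable g -> abs_summable (fun a => f a + g a).
Proof. exact: summableD. Qed.

Lemma abs_summableN f : abs_summable f -> abs_summable (fun a => - f a).
Proof. by move=> sf; apply: abs_summable_le sf _ => a; rewrite normrN. Qed.

Lemma le_esumZ k p : 0 <= k -> (forall a, 0 <= p a) ->
  (\esum_(a in [set: T]) (k * p a)%:E <= k%:E * \esum_(a in [set: T]) (p a)%:E)%E.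
Proof.
move=> k0 p0; apply: ge_ereal_sup => _ [A fA <-].
under eq_fsbigr do rewrite EFinM.
rewrite -ge0_mule_fsumr => [|a]; last by rewrite lee_fin.
by rewrite lee_wpmul2l ?lee_fin//; apply: ereal_sup_ubound; exists A.
Qed.

Lemma abs_summableZ k f : abs_summable f -> abs_summable (fun a => k * f a).
Proof.
move=> sf; rewrite /abs_summable /summable.
under eq_esum do rewrite /= normrM.
apply: le_lt_trans (le_esumZ _ _) _ => //.
by rewrite lte_mul_pinfty.
Qed.

(** The inequality missing from [le_esumZ] is [le_esumZ] itself, applied to the family [k * p] with
    the factor [k^-1]. *)
Lemma esumZ k p : 0 < k -> (forall a, 0 <= p a) ->
  (\esum_(a in [set: T]) (k * p a)%:E = k%:E * \esum_(a in [set: T]) (p a)%:E)%E.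
Proof.
move=> k0 p0; apply/eqP; rewrite eq_le le_esumZ ?(ltW k0)//=.
rewrite -(@lee_pmul2l _ k^-1%:E) ?fin_numE//; last by rewrite lte_fin invr_gt0.
rewrite muleA -EFinM mulVf ?gt_eqF// mul1e.
apply: le_trans (le_esumZ _ _); last 2 first.
- by rewrite invr_ge0 ltW.
- by move=> a; rewrite mulr_ge0// ltW.
by apply: le_esum => a _; rewrite mulrA mulVf ?gt_eqF// mul1r.
Qed.

Lemma fin_num_esum p : (forall a, 0 <= p a) -> abs_summable p ->
  (\esum_(a in [set: T]) (p a)%:E)%E \is a fin_num.
Proof.
move=> p0; rewrite /abs_summable summableE.
by under eq_esum do rewrite /= ger0_norm//.
Qed.

Lemma funrpos_le_norm f a : `|f^\+ a| <= `|f a|.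
Proof. by rewrite ger0_norm// ge_max normr_ge0 ler_norm. Qed.

Lemma funrneg_le_norm f a : `|f^\- a| <= `|f a|.
Proof. by rewrite ger0_norm ?le_max ?lexx ?orbT// ge_max normr_ge0 -normrN ler_norm. Qed.

(** Any splitting into nonnegative summable parts computes [rsum], not only the canonical one into
    positive and negative parts. Additivity of [rsum] thereby reduces to sums of nonnegative
    terms. *)
Lemma rsumB p q : (forall a, 0 <= p a) -> (forall a, 0 <= q a) ->
  abs_summable p -> abs_summable q ->
  rsum (fun a => p a - q a) =
  fine (\esum_(a in [set: T]) (p a)%:E)%E - fine (\esum_(a in [set: T]) (q a)%:E)%E.
Proof.
move=> p0 q0 sp sq.
have spq : abs_summable (fun a => p a - q a).
  exact: abs_summableD sp (abs_summableN sq).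
have finp : (\esum_(a in [set: T]) ((fun a => p a - q a)%R^\+ a)%:E)%E \is a fin_num.
  apply: fin_num_esum => //; apply: abs_summable_le spq _ => a.
  exact: funrpos_le_norm.
have finn : (\esum_(a in [set: T]) ((fun a => p a - q a)%R^\- a)%:E)%E \is a fin_num.
  apply: fin_num_esum => [a|]; first by rewrite le_max lexx orbT.
  by apply: abs_summable_le spq _ => a; exact: funrneg_le_norm.
have := @esumB R T setT (EFin \o p) (EFin \o q) sp sq.
move=> /(_ (fun a _ => p0 a) (fun a _ => q0 a)) /=.
rewrite /rsum -fineB // -fineB ?fin_num_esum// => <-.
congr (fine (_ - _)%E); apply: eq_esum => a _.
  by rewrite funeposE /= -EFinB EFin_max.
by rewrite funenegE /= EFin_max.
Qed.

Lemma rsumD f g : abs_summable f -> abs_summable g ->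
  rsum (fun a => f a + g a) = rsum f + rsum g.
Proof.
move=> sf sg.
have n0 h a : 0 <= h^\- a :> R by rewrite le_max lexx orbT.
have sp h : abs_summable h -> abs_summable h^\+.
  by move=> sh; apply: abs_summable_le sh _ => a; exact: funrpos_le_norm.
have sn h : abs_summable h -> abs_summable h^\-.
  by move=> sh; apply: abs_summable_le sh _ => a; exact: funrneg_le_norm.
have -> : (fun a => f a + g a) =
    (fun a => (f^\+ a + g^\+ a) - (f^\- a + g^\- a)).
  apply/funext => a; rewrite -[in LHS](funrposBneg f) -[in LHS](funrposBneg g).
  by rewrite !fctE; ring.
rewrite rsumB//; try by move=> a; rewrite addr_ge0.
- under eq_esum do rewrite EFinD.
  rewrite esumD//; try by move=> a _; rewrite lee_fin.
  under [in X in _ - X]eq_esum do rewrite EFinD.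
  rewrite [in X in _ - X]esumD//; try by move=> a _; rewrite lee_fin.
  rewrite !fineD ?fin_num_esum//; try exact: sp; try exact: sn.
  by rewrite /rsum; ring.
- by apply: abs_summableD; exact: sp.
- by apply: abs_summableD; exact: sn.
Qed.

Lemma rsumN f : rsum (fun a => - f a) = - rsum f.
Proof.
rewrite /rsum opprB; congr (fine _ - fine _); apply: eq_esum => a _.
by rewrite /funrneg /funrpos /= opprK.
Qed.

Lemma rsum0 : rsum (fun _ : T => 0 : R) = 0.
Proof. by rewrite /rsum !esum1 ?subr0// => a _; rewrite /funrneg /funrpos ?oppr0 maxxx. Qed.

Lemma rsumZ k f : abs_summable f -> rsum (fun a => k * f a) = k * rsum f.
Proof.
move=> sf; wlog k0 : k / 0 < k.
  move=> H; have [k0|k0|<-] := ltgtP 0 k; first exact: H.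
    have := H (- k); rewrite oppr_gt0 => /(_ k0) H'.
    rewrite -[LHS]opprK -rsumN; under eq_fun do rewrite -mulNr.
    by rewrite H' mulNr opprK.
  by under eq_fun do rewrite mul0r; rewrite rsum0 mul0r.
have n0 h a : 0 <= h^\- a :> R by rewrite le_max lexx orbT.
rewrite /rsum ge0_funrposM ?ltW// ge0_funrnegM ?ltW// !esumZ// ?fineM//.
- by rewrite mulrBr.
- by apply: fin_num_esum => //; apply: abs_summable_le sf _ => a; exact: funrneg_le_norm.
- by apply: fin_num_esum => //; apply: abs_summable_le sf _ => a; exact: funrpos_le_norm.
Qed.

Lemma rsum_sum n (f : 'I_n -> T -> R) : (forall i, abs_summable (f i)) ->
  abs_summable (fun a => \sum_(i < n) f i a) /\
  rsum (fun a => \sum_(i < n) f i a) = \sum_(i < n) rsum (f i).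
Proof.
elim: n f => [|n IHn] f sf.
  under eq_fun do rewrite big_ord0; rewrite rsum0 big_ord0; split=> //.
  by rewrite /abs_summable /summable esum1// => a _ /=; rewrite normr0.
under eq_fun do rewrite big_ord_recl; rewrite big_ord_recl.
have [sS eS] := IHn _ (fun i => sf (lift ord0 i)).
by split; [exact: abs_summableD|rewrite rsumD// eS].
Qed.

Lemma rsum_ge0 p : (forall a, 0 <= p a) -> 0 <= rsum p.
Proof.
move=> p0; rewrite /rsum [X in _ - fine X]esum1 ?subr0 => [|a _].
  by rewrite fine_ge0// esum_ge0// => a _; rewrite lee_fin.
by rewrite /funrneg /=; congr EFin; apply/max_idPr; rewrite oppr_le0.
Qed.

(** Both [p - f] and [p + f] are nonnegative, so their sums are too. *)
Lemma rsum_norm_le f p : abs_summable p -> (forall a, `|f a| <= p a) ->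
  `|rsum f| <= rsum p.
Proof.
move=> sp fp.
have sf : abs_summable f.
  by apply: abs_summable_le sp _ => a; apply: le_trans (fp a) (ler_norm _).
rewrite ler_norml -subr_ge0 opprK -[X in _ && X]subr_ge0 -rsumN -!rsumD//;
  last exact: abs_summableN.
by rewrite !rsum_ge0// => a; have := fp a; rewrite ler_norml => /andP[]; lra.
Qed.

End UnconditionalSums.

(** * Coefficientwise majorants of real polynomials, in the manner of Cauchy *)

Section Majorants.
Set Implicit Arguments. Unset Strict Implicit.
Context {R : realFieldType}.
Implicit Types (P Q B C : {poly R}) (s t : R).

Definition majorized P B := forall k, `|P`_k| <= B`_k.

Lemma majorized1 : majorized 1 1.
Proof. by move=> k; rewrite coef1 normr_nat. Qed.

Lemma majorizedM P Q B C :
  majorized P B -> majorized Q C -> majorized (P * Q) (B * C).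
Proof.
move=> PB QC k; rewrite !coefM; apply: le_trans (ler_norm_sum _ _ _) _.
by apply: ler_sum => i _; rewrite normrM ler_pM.
Qed.

Lemma majorizedX P B n : majorized P B -> majorized (P ^+ n) (B ^+ n).
Proof.
move=> PB; elim: n => [|n IHn]; first exact: majorized1.
by rewrite !exprS; exact: majorizedM.
Qed.

Lemma majorized_prod n (P B : 'I_n -> {poly R}) :
  (forall i, majorized (P i) (B i)) ->
  majorized (\prod_(i < n) P i) (\prod_(i < n) B i).
Proof.
move=> PB; elim/big_ind2: _ => [|P1 B1 P2 B2|i _ //]; first exact: majorized1.
exact: majorizedM.
Qed.

Lemma majorized_lin (x h rho H : R) : `|x| <= rho -> `|h| <= H ->
  majorized (x%:P + h *: 'X) (rho%:P + H *: 'X).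
Proof.
move=> xr hH [|[|k]]; rewrite !coefD !coefZ !coefC !coefX /= ?mulr0 ?addr0 ?mulr1 ?add0r//.
by rewrite normr0.
Qed.

(** A Cauchy estimate: [B.[s]] is a sum of nonnegative terms, and its [k]-th term already dominates
    the left-hand side. *)
Lemma majorized_coef P B s k : majorized P B -> 0 <= s ->
  `|P`_k| * s ^+ k <= B.[s].
Proof.
move=> PB s0; have B0 i : 0 <= B`_i by exact: le_trans (PB i).
rewrite (@horner_coef_wide _ (maxn (size B) k.+1)) ?leq_maxl//.
have kM : (k < maxn (size B) k.+1)%N by rewrite leq_maxr.
rewrite (bigD1 (Ordinal kM))//= ler_wpDr//; last first.
  by rewrite ler_wpM2r// exprn_ge0.
by apply: sumr_ge0 => i _; rewrite mulr_ge0// exprn_ge0.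
Qed.

(** For every order [k >= 2], [|t| <= s] gives [|t|^k <= (t / s)^2 * s^k]; summing against the
    coefficients of [B] bounds the remainder. *)
Lemma majorized_taylor1 P B s t : majorized P B -> 0 < s -> `|t| <= s ->
  `|P.[t] - P`_0 - t * P`_1| <= (t / s) ^+ 2 * B.[s].
Proof.
move=> PB s0 ts; have B0 i : 0 <= B`_i by exact: le_trans (PB i).
(* Padding both sums to length [n.+2] makes it possible to split off the terms of order 0 and 1. *)
set n := maxn (size P) (size B).
have nP : (size P <= n.+2)%N by rewrite 2?leqW// leq_maxl.
have nB : (size B <= n.+2)%N by rewrite 2?leqW// leq_maxr.
rewrite (horner_coef_wide _ nP) (horner_coef_wide _ nB).
rewrite 2!big_ord_recl /= expr0 mulr1 expr1.
have -> : forall S, P`_0 + (P`_1 * t + S) - P`_0 - t * P`_1 = S by move=> S; ring.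
rewrite 2!big_ord_recl /= !mulrDr.
have ts0 i : 0 <= (t / s) ^+ 2 * (B`_i * s ^+ i).
  by rewrite mulr_ge0 ?sqr_ge0// mulr_ge0// exprn_ge0// ltW.
do 2 (apply: ler_wpDl; first exact: ts0).
rewrite mulr_sumr; apply: le_trans (ler_norm_sum _ _ _) _.
apply: ler_sum => i _; rewrite /bump !leq0n !add1n normrM normrX.
have -> : (t / s) ^+ 2 * (B`_i.+2 * s ^+ i.+2) = B`_i.+2 * (`|t| ^+ 2 * s ^+ i).
  by rewrite real_normK ?num_real// expr_div_n !exprS; field; rewrite gt_eqF.
apply: ler_pM => //.
by rewrite !exprS expr0 mulr1 mulrA ler_wpM2l ?mulr_ge0// lerXn2r// nnegrE ltW.
Qed.

End Majorants.

(** * Monomials restricted to a line, as polynomials in the line parameter *)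

Section MonomialsOnLines.
Set Implicit Arguments. Unset Strict Implicit.
Context {R : realFieldType} {n : nat}.
Implicit Types (x h : 'rV[R]_n) (e : 'I_n -> nat).

Definition line_mono x h e : {poly R} :=
  \prod_(j < n) ((x 0 j)%:P + h 0 j *: 'X) ^+ e j.

Lemma horner_line_mono x h e t :
  (line_mono x h e).[t] = \prod_(j < n) (x + t *: h) 0 j ^+ e j.
Proof.
rewrite horner_prod; apply: eq_bigr => j _.
by rewrite horner_exp !hornerE !mxE [t * _]mulrC.
Qed.

Lemma coef0_line_mono x h e : (line_mono x h e)`_0 = \prod_(j < n) x 0 j ^+ e j.
Proof. by rewrite -horner_coef0 horner_line_mono scale0r addr0. Qed.

Lemma majorized_line_mono x h e rho H :
  (forall j, `|x 0 j| <= rho) -> (forall j, `|h 0 j| <= H) ->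
  majorized (line_mono x h e) ((rho%:P + H *: 'X) ^+ (\sum_(j < n) e j)).
Proof.
move=> xr hH; rewrite expr_sum; apply: majorized_prod => j.
exact/majorizedX/majorized_lin.
Qed.

(** The constant coefficient does not depend on the direction, and the next one is linear in it.
    This property is stable under products and holds for each linear factor of a monomial. *)
Let first_order (P : 'rV[R]_n -> {poly R}) := exists c (d : 'I_n -> R),
  forall h, (P h)`_0 = c /\ (P h)`_1 = \sum_(j < n) h 0 j * d j.

Let first_orderM P Q :
  first_order P -> first_order Q -> first_order (fun h => P h * Q h).
Proof.
move=> [c [d Pd]] [c' [d' Qd]].
exists (c * c'), (fun j => c * d' j + c' * d j) => h.
have [P0 P1] := Pd h; have [Q0 Q1] := Qd h; split.
  by rewrite coefM big_ord1 P0 Q0.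
rewrite coefM !big_ord_recl big_ord0 /= P0 P1 Q0 Q1.
rewrite mulr_sumr mulr_suml addr0 -big_split.
by apply: eq_bigr => j _ /=; ring.
Qed.

Let first_order1 : first_order (fun=> 1).
Proof.
exists 1, (fun=> 0) => h; rewrite !coef1; split => //=.
by rewrite big1// => j _; rewrite mulr0.
Qed.

(** The first coefficient is the derivative of the monomial along [h]; its linearity in [h] is
    obtained from [first_order], factor by factor. *)
Lemma coef1_line_mono x h e :
  (line_mono x h e)`_1 = \sum_(j < n) h 0 j * (line_mono x (delta_mx 0 j) e)`_1.
Proof.
have [c [d Pd]] : first_order (fun h => line_mono x h e).
  rewrite /line_mono; elim: (index_enum _) => [|j l IHl].
    under eq_fun do rewrite big_nil; exact: first_order1.
  under eq_fun do rewrite big_cons; apply: first_orderM => //.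
  elim: (e j) => [|k IHk]; first exact: first_order1.
  under eq_fun do rewrite exprS; apply: first_orderM => //.
  exists (x 0 j), (fun i => (i == j)%:R) => h'.
  rewrite !coefD !coefZ !coefC !coefX /= mulr0 addr0 mulr1 add0r; split => //.
  rewrite (bigD1 j)//= eqxx mulr1 big1 ?addr0// => i /negPf ->.
  by rewrite mulr0.
rewrite (Pd h).2; apply: eq_bigr => j _; congr (_ * _).
rewrite (Pd _).2 (bigD1 j)//= big1 => [|i /negPf ij].
  by rewrite mxE !eqxx mul1r addr0.
by rewrite mxE ij mul0r.
Qed.

End MonomialsOnLines.

(** A quadratic error makes the difference quotient deviate from [d] by at most [|h| * K]. Dividing
    by [|K| + 1] in the proof avoids any condition on the sign of [K]. *)
Lemma is_derive_quadratic {R : realType} (f : R -> R) (d s K : R) : 0 < s ->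
  (forall t, `|t| <= s -> `|f t - f 0 - t * d| <= t ^+ 2 * K) ->
  is_derive (0 : R) (1 : R) f d.
Proof.
move=> s0 fK.
have fd : h^-1 *: (f (h *: (1 : R) + 0) - f 0) @[h --> (0 : R)^'] --> d.
  apply/cvgrPdist_le => eps eps0.
  have K1 : 0 < `|K| + 1 by rewrite ltr_wpDl.
  near=> h.
  have h0 : h != 0 by near: h; exact: nbhs_dnbhs_neq.
  have hs : `|h| <= s.
    by near: h; apply: dnbhs0_le.
  have he : `|h| <= eps / (`|K| + 1).
    by near: h; apply: dnbhs0_le; rewrite divr_gt0.
  rewrite addr0 [h *: 1]mulr1 distrC.
  have -> : h^-1 *: (f h - f 0) - d = h^-1 * (f h - f 0 - h * d).
    by rewrite /GRing.scale /=; field.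
  rewrite normrM normfV ler_pdivrMl ?normr_gt0//.
  apply: le_trans (fK h hs) _.
  rewrite -real_normK ?num_real// expr2 -mulrA ler_wpM2l//.
  apply: le_trans (_ : `|h| * (`|K| + 1) <= _).
    by rewrite ler_wpM2l// (le_trans (ler_norm _))// lerDl.
  by rewrite -ler_pdivlMr.
apply: DeriveDef; first by apply/cvg_ex; exists d.
exact: cvg_lim.
Unshelve. all: by end_near. Qed.

(** * Differentiability and growth of convergent power series in [n] variables *)

Section PowerSeries.
Set Implicit Arguments. Unset Strict Implicit.
Context {R : realType} {T : choiceType} {n : nat}.
Variables (c : T -> R) (e : T -> 'I_n -> nat) (r : R).
Implicit Types x h : 'rV[R]_n.

Definition mdeg a := (\sum_(j < n) e a j)%N.

Definition power_series x := rsum (fun a => c a * \prod_(j < n) x 0 j ^+ e a j).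

(** Convergence on the diagonal controls the whole box, since a monomial at a point with coordinates
    bounded by [rho] is at most [rho ^+ mdeg a]. *)
Hypothesis c_summable : forall rho : R, 0 <= rho -> rho < r ->
  abs_summable (fun a => c a * rho ^+ mdeg a).

Let prodX x rho a : (forall j, `|x 0 j| <= rho) ->
  `|\prod_(j < n) x 0 j ^+ e a j| <= rho ^+ mdeg a.
Proof.
move=> xr; rewrite /mdeg expr_sum normr_prod; apply: ler_prod => j _.
rewrite normrX exprn_ge0//= lerXn2r// nnegrE//.
exact: le_trans (xr j).
Qed.

Lemma row_strict_bound x : (forall j, `|x 0 j| < r) -> 0 < r ->
  exists2 rho, 0 <= rho < r & forall j, `|x 0 j| <= rho.
Proof.
move=> xr r0; exists (\big[Num.max/0]_(j < n) `|x 0 j|).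
  rewrite bigmax_ge_id /=; apply/bigmax_ltP; split => // i _; exact: xr.
by move=> j; exact: le_bigmax.
Qed.

Lemma row_pos_bound h : exists2 H, 0 < H & forall j, `|h 0 j| <= H.
Proof.
exists (1 + \sum_(j < n) `|h 0 j|); first by rewrite ltr_pwDl// sumr_ge0.
by move=> j; rewrite (bigD1 j)//= addrCA lerDl addr_ge0// sumr_ge0.
Qed.

(** Each monomial on the line is majorized by a power of [rho + H X], whose value at
    [(rho' - rho) / H] is a power of [rho']. The one convergent sum [S] thus controls all first
    coefficients and all Taylor remainders. A single [D] serves every direction [h], as needed for a
    gradient. *)
Lemma power_series_is_derive x : 0 < r -> (forall j, `|x 0 j| < r) ->
  exists D : 'I_n -> R, forall h, is_derive (0 : R) (1 : R)
    (fun t => power_series (x + t *: h)) (\sum_(j < n) h 0 j * D j).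
Proof.
move=> r0 xr; have [rho /andP[rho0 rhor] xrho] := row_strict_bound xr r0.
(* The midpoint leaves room to move away from [x] while staying inside the domain of convergence. *)
pose rho' := (rho + r) / 2.
have rr' : rho < rho' by rewrite /rho'; lra.
have r'r : rho' < r by rewrite /rho'; lra.
have r'0 : 0 <= rho' by lra.
pose S := rsum (fun a => `|c a| * rho' ^+ mdeg a).
have sS : abs_summable (fun a => `|c a| * rho' ^+ mdeg a).
  by apply: abs_summable_le (c_summable r'0 r'r) _ => a; rewrite !normrM normr_id.
pose d h a := (line_mono x h (e a))`_1.
have maj h H a : (forall j, `|h 0 j| <= H) -> 0 < H ->
    majorized (line_mono x h (e a)) ((rho%:P + H *: 'X) ^+ mdeg a) /\
    ((rho%:P + H *: 'X) ^+ mdeg a).[(rho' - rho) / H] = rho' ^+ mdeg a.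
  move=> hH H0; split; first exact: majorized_line_mono.
  rewrite horner_exp hornerD hornerC hornerZ hornerX [H * _]mulrC divfK ?gt_eqF//.
  by rewrite addrC subrK.
have sd h : abs_summable (fun a => c a * d h a).
  have [H H0 hH] := row_pos_bound h.
  pose s := (rho' - rho) / H.
  have s0 : 0 < s by rewrite divr_gt0// subr_gt0.
  apply: abs_summable_le (abs_summableZ s^-1 sS) _ => a.
  rewrite !normrM normr_id mulrCA ler_wpM2l// normfV (gtr0_norm s0) mulrC ler_pdivlMr//.
  have [mj ev] := maj h H a hH H0.
  rewrite (ger0_norm (exprn_ge0 _ r'0)) -ev.
  by have := majorized_coef 1 mj (ltW s0); rewrite expr1.
exists (fun j => rsum (fun a => c a * d (delta_mx 0 j) a)) => h.
have -> : \sum_(j < n) h 0 j * rsum (fun a => c a * d (delta_mx 0 j) a)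
    = rsum (fun a => c a * d h a).
  have := @rsum_sum R T n (fun j a => h 0 j * (c a * d (delta_mx 0 j) a)).
  case=> [j|_ E]; first exact: abs_summableZ.
  under eq_bigr do rewrite -rsumZ//.
  rewrite -E; congr rsum; apply/funext => a.
  rewrite /d coef1_line_mono mulr_sumr; apply: eq_bigr => j _; ring.
have [H H0 hH] := row_pos_bound h.
pose s := (rho' - rho) / H.
have s0 : 0 < s by rewrite divr_gt0// subr_gt0.
(* The remainder of the term of index [a] is at most [(t / s)^2 * |c a| * rho'^(mdeg a)]; these
   bounds add up to [t^2 * (s^-2 * S)]. *)
apply: (is_derive_quadratic (s := s) (K := s ^- 2 * S)) => // t ts.
have sF t' : `|t'| <= s ->
    abs_summable (fun a => c a * \prod_(j < n) (x + t' *: h) 0 j ^+ e a j).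
  move=> t's; apply: abs_summable_le sS _ => a.
  rewrite !normrM normr_id ler_wpM2l// (ger0_norm (exprn_ge0 _ r'0)).
  apply: prodX => j; rewrite !mxE; apply: le_trans (ler_normD _ _) _.
  rewrite normrM; apply: le_trans (lerD (xrho j) (ler_pM _ _ t's (hH j))) _ => //.
  by rewrite /s divfK ?gt_eqF//; lra.
have -> : power_series (x + t *: h) - power_series (x + 0 *: h)
    - t * rsum (fun a => c a * d h a)
   = rsum (fun a => c a * ((line_mono x h (e a)).[t] - (line_mono x h (e a))`_0 - t * d h a)).
  have sF0 := abs_summableN (sF 0 _); rewrite normr0 in sF0.
  have sFt := abs_summableD (sF t ts) (sF0 (ltW s0)).
  have sdt := abs_summableN (abs_summableZ t (sd h)).
  rewrite -rsumZ// -!rsumN /power_series -rsumD ?sF0 ?ltW ?sF// -rsumD//.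
  congr rsum; apply/funext => a; rewrite scale0r addr0 horner_line_mono coef0_line_mono.
  by ring.
rewrite mulrA -exprVn -exprMn -rsumZ//.
apply: rsum_norm_le => [|a]; first exact: abs_summableZ.
rewrite normrM mulrCA ler_wpM2l//.
have [mj <-] := maj h H a hH H0.
exact: majorized_taylor1.
Qed.

(** Without a constant term, every monomial contributes at least one factor [delta]; the other
    factors are bounded by [rho = r / 2]. *)
Lemma power_series_near0 : 0 < r -> (forall a, mdeg a = 0%N -> c a = 0) ->
  exists K : R, forall (delta : R) x, 0 <= delta <= r / 2 ->
    (forall j, `|x 0 j| <= delta) -> `|power_series x| <= delta * K.
Proof.
move=> r0 c0; pose rho := r / 2.
have rho0 : 0 < rho by rewrite divr_gt0.
have sS : abs_summable (fun a => `|c a| * rho ^+ mdeg a).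
  have rr : rho < r by rewrite /rho; lra.
  by apply: abs_summable_le (c_summable (ltW rho0) rr) _ => a; rewrite !normrM normr_id.
exists (rho^-1 * rsum (fun a => `|c a| * rho ^+ mdeg a)) => delta x /andP[d0 dr] xd.
rewrite mulrA -rsumZ//; apply: rsum_norm_le => [|a]; first exact: abs_summableZ.
have [m0|m0] := posnP (mdeg a); first by rewrite c0// !mul0r normr0 !mul0r mulr0.
rewrite normrM mulrCA ler_wpM2l//; apply: le_trans (prodX a xd) _.
rewrite -(prednK m0) !exprS -mulrA mulKf ?gt_eqF//.
by rewrite ler_wpM2l// lerXn2r// nnegrE ltW.
Qed.

End PowerSeries.

(** * Vanishing of a function whose gradient is bounded by its values *)

Lemma is_derive_line {R : realType} {n : nat} (g : 'rV[R]_n -> R) (x h : 'rV[R]_n)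
    (t d : R) :
  is_derive (0 : R) (1 : R) (fun s => g (x + t *: h + s *: h)) d ->
  is_derive t (1 : R) (fun s => g (x + s *: h)) d.
Proof.
move=> gd.
have -> : (fun s => g (x + s *: h)) =
    (fun s => g (x + t *: h + s *: h)) \o shift (- t).
  apply/funext => s /=; congr g.
  by rewrite -addrA -scalerDl addrCA subrr addr0.
have s1 : is_derive t (1 : R) (shift (- t)) (1 : R) by exact: is_derive_shift.
rewrite -[d]mulr1; apply: is_derive1_comp.
by rewrite /= subrr.
Qed.

(* Along the ray through [x] the mean value theorem gives
   [|g x| <= |g y| / 2] for another point [y] of the box, whence [sup |g| = 0]. *)
Lemma vanishing_of_small_gradient {R : realType} {n : nat} (g : 'rV[R]_n -> R)
    (G : 'rV[R]_n -> 'rV[R]_n -> R) (delta M : R) :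
  let box (x : 'rV[R]_n) := forall j, `|x 0 j| < delta in
  (forall x, box x -> forall h,
     is_derive (0 : R) (1 : R) (fun t => g (x + t *: h)) (G x h)) ->
  (forall x h, box x -> box h -> `|G x h| <= `|g x| / 2) ->
  (forall x, box x -> `|g x| <= M) -> g 0 = 0 ->
  forall x, box x -> g x = 0.
Proof.
move=> box gG G2 gM g0.
have half x : box x -> exists2 y, box y & `|g x| <= `|g y| / 2.
  move=> bx.
  have bt (t : R) : 0 <= t <= 1 -> box (0 + t *: x).
    move=> /andP[t0 t1] j; rewrite add0r mxE normrM ger0_norm//.
    by apply: le_lt_trans (bx j); rewrite ler_piMl.
  have dt (t : R) : 0 <= t <= 1 ->
      is_derive t (1 : R) (fun s => g (0 + s *: x)) (G (0 + t *: x) x).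
    by move=> t01; apply: is_derive_line; apply: gG; exact: bt.
  have [||t t01] := @MVT R (fun s => g (0 + s *: x))
    (fun t => G (0 + t *: x) x) (0 : R) (1 : R) ltr01.
  - by move=> t; rewrite in_itv /= => /andP[t0 t1]; apply: dt; rewrite !ltW.
  - apply: derivable_within_continuous => t; rewrite in_itv /= => t01.
    by have [] := dt t t01.
  rewrite scale1r scale0r !add0r g0 !subr0 mulr1 => gx.
  move: t01; rewrite in_itv /= => /andP[t0 t1].
  have bty : box (t *: x) by rewrite -[t *: x]add0r; apply: bt; rewrite !ltW.
  by exists (t *: x) => //; rewrite gx; exact: G2.
move=> x bx.
pose E := [set `|g y| | y in box].
have supE : has_sup E.
  split; first by exists `|g x|, x.
  by exists M => _ [y yb <-]; exact: gM.
have lesup y : box y -> `|g y| <= sup E.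
  by move=> yb; apply: ub_le_sup; [exact: (proj2 supE)|exists y].
have : sup E <= sup E / 2.
  apply: ge_sup; first exact: (proj1 supE).
  move=> _ [y /half[z zb yz] <-]; apply: le_trans yz _.
  by rewrite ler_wpM2r// lesup.
have := lesup _ bx => xE E2.
apply/eqP; rewrite -normr_le0; apply: le_trans xE _; lra.
Qed.

(** * Real coordinates: five graph coordinates and the height [v] *)

Section Coordinates.
Set Implicit Arguments. Unset Strict Implicit.
Context {R : realType}.
Local Notation C := R[i].
Implicit Types (p q : 'rV[C]_3) (x h : 'rV[R]_5).

Definition row5 (s : seq R) : 'rV[R]_5 := \row_j nth 0 s j.

Definition base p : 'rV[R]_5 :=
  row5 [:: complex.Re (z1 p); complex.Im (z1 p); complex.Re (z2 p);
           complex.Im (z2 p); complex.Re (w p)].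

Definition height p : R := complex.Im (w p).

Definition point_over x (v : R) : 'rV[C]_3 :=
  \row_(j < 3) nth 0 [:: Complex (x 0 (inord 0)) (x 0 (inord 1));
                         Complex (x 0 (inord 2)) (x 0 (inord 3));
                         Complex (x 0 (inord 4)) v] j.

(** Turns the tuple index of the normal form into an exponent vector, so that the results on
    [power_series] apply to [Fval]. *)
Definition exponents (a : midx) (j : 'I_5) : nat :=
  let: (a1, b1, a2, b2, e) := a in nth 0%N [:: a1; b1; a2; b2; e] j.

Lemma base_over x v : base (point_over x v) = x.
Proof.
apply/rowP => j; rewrite mxE /z1 /z2 /w !mxE !inordK//=.
by case: j => [[|[|[|[|[|//]]]]] jl] /=; congr (x _ _); apply/val_inj; rewrite /= inordK.
Qed.

Lemma height_over x v : height (point_over x v) = v.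
Proof. by rewrite /height /w mxE inordK. Qed.

Lemma Re_addc (a b : C) : complex.Re (a + b) = complex.Re a + complex.Re b.
Proof. by case: a; case: b. Qed.
Lemma Im_addc (a b : C) : complex.Im (a + b) = complex.Im a + complex.Im b.
Proof. by case: a; case: b. Qed.
Lemma Re_mulc (a b : C) : complex.Re (a * b) =
  complex.Re a * complex.Re b - complex.Im a * complex.Im b.
Proof. by case: a; case: b. Qed.
Lemma Im_mulc (a b : C) : complex.Im (a * b) =
  complex.Re a * complex.Im b + complex.Im a * complex.Re b.
Proof. by case: a; case: b => /= *; rewrite addrC. Qed.

Lemma base_line p q (t : R) : base (p + (t%:C)%C *: q) = base p + t *: base q.
Proof.
apply/rowP => j; rewrite !mxE /z1 /z2 /w !mxE.
by case: j => [[|[|[|[|[|//]]]]] jl] /=; 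
  rewrite ?Re_addc ?Im_addc ?Re_mulc ?Im_mulc /= ?mul0r ?subr0 ?addr0.
Qed.

Lemma height_line p q (t : R) : height (p + (t%:C)%C *: q) = height p + t * height q.
Proof. by rewrite /height /w !mxE Im_addc Im_mulc /= mul0r addr0. Qed.

Lemma mono_prod (x1 y1 x2 y2 u : R) a :
  mono x1 y1 x2 y2 u a = \prod_(j < 5) (row5 [:: x1; y1; x2; y2; u]) 0 j ^+ exponents a j.
Proof.
case: a => [[[[a1 b1] a2] b2] e].
by rewrite !big_ord_recl big_ord0 !mxE /= mulr1 !mulrA.
Qed.

Lemma Fval_base (c : midx -> R) p : Fval c p = power_series c exponents (base p).
Proof.
by congr rsum; apply/funext => a; rewrite mono_prod.
Qed.

Lemma mdeg_exponents_eq0 a : mdeg exponents a = 0%N -> a = (0, 0, 0, 0, 0)%N.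
Proof.
case: a => [[[[a1 b1] a2] b2] e].
by rewrite /mdeg !big_ord_recl big_ord0 /= => E; congr (_, _, _, _, _); lia.
Qed.

(** The convergence required on the box is evaluated at the diagonal point
    [(rho, rho, rho, rho, rho)]. *)
Lemma normal_form_summable r (c : midx -> R) : normal_form_data r c ->
  forall rho : R, 0 <= rho -> rho < r ->
  abs_summable (fun a => c a * rho ^+ mdeg exponents a).
Proof.
move=> [r0 sc _] rho rho0 rhor.
have := sc rho rho rho rho rho; rewrite /in_box ger0_norm//.
move=> /(_ (And5 rhor rhor rhor rhor rhor)); congr summable; apply/funext => a /=.
case: a => [[[[a1 b1] a2] b2] e]; congr (_ * _)%:E.
by rewrite /mdeg !big_ord_recl big_ord0 /= addn0 !exprD !mulrA.
Qed.

End Coordinates.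

(** * Tangent affine fields and the vanishing of the defect on the hypersurface *)

Section TangentFields.
Set Implicit Arguments. Unset Strict Implicit.
Context {R : realType}.
Local Notation C := R[i].
Implicit Types (p q : 'rV[C]_3) (x h : 'rV[R]_5) (N : 'M[C]_4).

Lemma point_coord_le p (rho : R) : (forall j, `|base p 0 j| <= rho) ->
  `|height p| <= rho ->
  forall k, `|complex.Re (p 0 k)| <= rho /\ `|complex.Im (p 0 k)| <= rho.
Proof.
move=> bp hp k.
have b i : (i < 5)%N -> `|nth 0 [:: complex.Re (z1 p); complex.Im (z1 p); complex.Re (z2 p);
           complex.Im (z2 p); complex.Re (w p)] i| <= rho.
  by move=> i5; have := bp (Ordinal i5); rewrite mxE.
have -> : k = inord k :> 'I_3 by rewrite inord_val.
case: k => [[|[|[|//]]]] kl /=; split=> //.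
- exact: (b 0%N).
- exact: (b 1%N).
- exact: (b 2%N).
- exact: (b 3%N).
- exact: (b 4%N).
Qed.

(** The difference is the linear part of the field, so [K] can be the sum of the sizes of its nine
    coefficients. This keeps the projected fields close to their values at the origin. *)
Lemma vfield_bound N : exists2 K : R, 0 <= K & forall p (rho : R),
  (forall j, `|base p 0 j| <= rho) -> `|height p| <= rho ->
  forall j, `|base (vfield N p) 0 j - base (vfield N 0) 0 j| <= K * rho.
Proof.
pose m (z : C) := `|complex.Re z| + `|complex.Im z|.
have m0 z : 0 <= m z by rewrite addr_ge0.
pose K := \sum_(i < 3) \sum_(k < 3) m (N (inord i) (inord k)).
exists K => [|p rho bp hp]; first by rewrite !sumr_ge0// => i _; rewrite sumr_ge0.
have cp := point_coord_le bp hp.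
have rho0 : 0 <= rho by exact: le_trans hp.
pose L (i : 'I_3) : C := \sum_(k < 3) N (inord i) (inord k) * p 0 k.
have L_le i : `|complex.Re (L i)| <= K * rho /\ `|complex.Im (L i)| <= K * rho.
  have row_le : (\sum_(k < 3) m (N (inord i) (inord k))) * rho <= K * rho.
    by rewrite ler_wpM2r// [K](bigD1 i)//= lerDl sumr_ge0// => l _; rewrite sumr_ge0.
  suff : `|complex.Re (L i)| <= (\sum_(k < 3) m (N (inord i) (inord k))) * rho /\
         `|complex.Im (L i)| <= (\sum_(k < 3) m (N (inord i) (inord k))) * rho.
    by move=> [h1 h2]; split; exact: le_trans row_le.
  rewrite /L; elim/big_ind2: _ => [|z1 s1 z2 s2 [h1 h2] [h3 h4]|k _].
  - by rewrite !mul0r normr0.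
  - rewrite Re_addc Im_addc mulrDl; split; apply: le_trans (ler_normD _ _) _; exact: lerD.
  - have [h1 h2] := cp k.
    rewrite Re_mulc Im_mulc /m mulrDl; split.
      by apply: le_trans (ler_normB _ _) _; rewrite !normrM lerD// ler_wpM2l.
    by apply: le_trans (ler_normD _ _) _; rewrite !normrM lerD// ler_wpM2l.
have vE i : vfield N p 0 i = L i + vfield N 0 0 i.
  rewrite !mxE addrA; congr (_ + _); rewrite -[LHS]addr0; congr (_ + _).
  by rewrite big1// => k _; rewrite mxE mulr0.
move=> j; rewrite !mxE /z1 /z2 /w !vE.
case: j => [[|[|[|[|[|//]]]]] jl] /=; rewrite ?Re_addc ?Im_addc addrK.
- exact: (L_le _).1.
- exact: (L_le _).2.
- exact: (L_le _).1.
- exact: (L_le _).2.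
- exact: (L_le _).1.
Qed.

(* The candidate quadric is [v = 2 (x1 + a v)^2 + |z2|^2], with [x = (x1, y1, x2, y2, u)];
   [ddefect a x v h k] is the differential of [defect a] at [(x, v)] along [(h, k)]. *)
Definition defect (a : R) (x : 'rV[R]_5) (v : R) : R :=
  v - 2 * (x 0 (inord 0) + a * v) ^+ 2 - x 0 (inord 2) ^+ 2 - x 0 (inord 3) ^+ 2.

Definition ddefect (a : R) (x : 'rV[R]_5) (v : R) (h : 'rV[R]_5) (k : R) : R :=
  k - 4 * (x 0 (inord 0) + a * v) * (h 0 (inord 0) + a * k)
    - 2 * x 0 (inord 2) * h 0 (inord 2) - 2 * x 0 (inord 3) * h 0 (inord 3).

Lemma is_derive_defect a (x h : 'rV[R]_5) (f : R -> R) (d : R) :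
  is_derive (0 : R) (1 : R) f d ->
  is_derive (0 : R) (1 : R) (fun t => defect a (x + t *: h) (f t))
    (ddefect a x (f 0) h d).
Proof.
move=> fd; have -> : (fun t => defect a (x + t *: h) (f t)) = (fun t =>
    f t - 2 * (x 0 (inord 0) + t * h 0 (inord 0) + a * f t) ^+ 2
     - (x 0 (inord 2) + t * h 0 (inord 2)) ^+ 2
     - (x 0 (inord 3) + t * h 0 (inord 3)) ^+ 2).
  by apply/funext => t; rewrite /defect !mxE.
apply: is_derive_eq.
rewrite /ddefect /GRing.scale /=.
ring.
Qed.

(** The differential is linear in [(h, k)]. When [D] is the gradient of the graph function, the
    right-hand side is the derivative along [b] of the defect restricted to the graph. *)
Lemma ddefect_sum a x v (D : 'I_5 -> R) (b : 'rV[R]_5) :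
  ddefect a x v b (\sum_(j < 5) b 0 j * D j) =
  \sum_(j < 5) b 0 j * ddefect a x v (delta_mx 0 j) (D j).
Proof.
have bE i : b 0 i = \sum_(j < 5) b 0 j * (delta_mx 0 j : 'rV[R]_5) 0 i.
  rewrite (bigD1 i)//= mxE !eqxx mulr1 big1 ?addr0// => j /negPf ji.
  by rewrite mxE eq_sym ji andbF mulr0.
pose X := x 0 (inord 0) + a * v.
have -> : \sum_(j < 5) b 0 j * ddefect a x v (delta_mx 0 j) (D j) =
    (1 - 4 * X * a) * (\sum_(j < 5) b 0 j * D j)
    - 4 * X * b 0 (inord 0) - 2 * x 0 (inord 2) * b 0 (inord 2)
    - 2 * x 0 (inord 3) * b 0 (inord 3).
  rewrite (bE (inord 0)) (bE (inord 2)) (bE (inord 3)) !mulr_sumr -!sumrB.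
  by apply: eq_bigr => j _; rewrite /ddefect /X; ring.
by rewrite /ddefect /X; ring.
Qed.

Lemma defect_bound a x (v delta eta : R) : (forall j, `|x 0 j| <= delta) ->
  `|v| <= eta ->
  `|defect a x v| <= eta + 2 * (delta + `|a| * eta) ^+ 2 + delta ^+ 2 + delta ^+ 2.
Proof.
move=> xd ve.
have sq (y B : R) : `|y| <= B -> `|y ^+ 2| <= B ^+ 2.
  by move=> yB; rewrite normrX lerXn2r// nnegrE (le_trans _ yB).
apply: le_trans (ler_normB _ _) _; apply: lerD; last exact: sq.
apply: le_trans (ler_normB _ _) _; apply: lerD; last exact: sq.
apply: le_trans (ler_normB _ _) _; apply: lerD => //.
rewrite normrM normr_nat ler_wpM2l// sq//.
by apply: le_trans (ler_normD _ _) _; rewrite lerD// normrM ler_wpM2l.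
Qed.

Lemma in_box_base (r : R) p :
  in_box r (complex.Re (z1 p)) (complex.Im (z1 p)) (complex.Re (z2 p))
    (complex.Im (z2 p)) (complex.Re (w p)) <-> forall j, `|base p 0 j| < r.
Proof.
split.
  move=> [h1 h2 h3 h4 h5] j; rewrite mxE.
  by case: j => [[|[|[|[|[|//]]]]] jl].
move=> H; have b i (i5 : (i < 5)%N) := H (Ordinal i5).
have := (b 0%N isT, b 1%N isT, b 2%N isT, b 3%N isT, b 4%N isT).
by rewrite !mxE /= => -[[[[]]]].
Qed.

(** Along the line in direction [Z], [Phi] is the power series on the projected line minus an affine
    function of [t]; tangency equates the two slopes. *)
Lemma tangent_gradient (r : R) (c : midx -> R) N x (D : 'I_5 -> R) :
  (forall j, `|x 0 j| < r) -> tangent_to N r c ->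
  (forall h, is_derive (0 : R) (1 : R)
    (fun t => power_series c exponents (x + t *: h)) (\sum_(j < 5) h 0 j * D j)) ->
  let Z := vfield N (point_over x (power_series c exponents x)) in
  height Z = \sum_(j < 5) base Z 0 j * D j.
Proof.
move=> xr tN dF Z; pose p := point_over x (power_series c exponents x).
have Mp : hyps r c p.
  split; first by apply/in_box_base; rewrite base_over.
  by rewrite Fval_base base_over; exact: height_over.
have := tN p Mp; rewrite derive1E.
have -> : (fun t : R => Phi c (p + (t%:C)%C *: vfield N p)) =
    (fun t => power_series c exponents (x + t *: base Z) - (height p + t * height Z)).
  apply/funext => t; rewrite /Phi Fval_base base_line base_over.
  by rewrite -/(height _) height_line.
have dZ := dF (base Z).
have dP : is_derive (0 : R) (1 : R)
    (fun t => power_series c exponents (x + t *: base Z) - (height p + t * height Z))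
    (\sum_(j < 5) base Z 0 j * D j - height Z).
  apply: is_derive_eq; rewrite /GRing.scale /=; congr (_ - _).
  by rewrite mul0r !add0r mul1r mulr1.
by rewrite derive_val => /eqP; rewrite subr_eq0 => /eqP.
Qed.

(** A quantitative inversion: the entries deviate from the identity by at most [1 / (2 n)], so the
    deviations contribute at most half of the left-hand sum, which is absorbed. *)
Lemma near_identity_bound n (b : 'I_n -> 'rV[R]_n) (y : 'I_n -> R) (l : 'I_n -> R) :
  (forall k j, n%:R * `|b k 0 j - (k == j)%:R| <= 1 / 2) ->
  (forall k, \sum_(j < n) b k 0 j * y j = l k) ->
  \sum_(k < n) `|y k| <= 2 * \sum_(k < n) `|l k|.
Proof.
move=> bI by_; set S := \sum_(k < n) `|y k|.
case: n => [|n] in b y l bI by_ S *; first by rewrite /S !big_ord0 mulr0.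
have yk k : `|y k| <= `|l k| + (n.+1%:R)^-1 / 2 * S.
  have -> : y k = l k - \sum_(j < n.+1) (b k 0 j - (k == j)%:R) * y j.
    rewrite -by_ -sumrB (bigD1 k)//= eqxx mulr1n big1 ?addr0; first by ring.
    by move=> j /negPf kj; rewrite eq_sym kj mulr0n; ring.
  apply: le_trans (ler_normB _ _) _; rewrite lerD2l.
  apply: le_trans (ler_norm_sum _ _ _) _; rewrite mulr_sumr.
  apply: ler_sum => j _; rewrite normrM ler_wpM2r//.
  by rewrite -(ler_pM2l (_ : 0 < n.+1%:R)) ?ltr0n// mulrA divff ?pnatr_eq0.
have : S <= \sum_(k < n.+1) (`|l k| + (n.+1%:R)^-1 / 2 * S).
  by apply: ler_sum => k _; exact: yk.
rewrite big_split /= sumr_const card_ord -[X in _ <= _ + X]mulr_natl.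
have -> : n.+1%:R * (n.+1%:R^-1 / 2 * S) = S / 2.
  by rewrite !mulrA divff ?pnatr_eq0// mul1r mulrC.
lra.
Qed.

Lemma common_lower_bound (s : seq R) : all (fun e => 0 < e) s ->
  exists2 d, 0 < d & all (fun e => d <= e) s.
Proof.
elim: s => [|e s IHs] /=; first by exists 1.
move=> /andP[e0 /IHs[d d0 ds]]; exists (Num.min e d); first by rewrite lt_min e0.
rewrite ge_min lexx /=; apply: sub_all ds => f df.
by rewrite ge_min df orbT.
Qed.

Lemma defect_vanishes (r : R) (c : midx -> R) a (N : 'I_5 -> 'M[C]_4) (lam : 'I_5 -> R) :
  normal_form_data r c ->
  (forall k, base (vfield (N k) 0) = delta_mx 0 k) ->
  (forall k p, let Z := vfield (N k) p in
     ddefect a (base p) (height p) (base Z) (height Z) =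
     lam k * defect a (base p) (height p)) ->
  (forall k, tangent_to (N k) r c) ->
  forall eta : R, 0 < eta -> exists2 delta, 0 < delta <= r &
    forall x, (forall j, `|x 0 j| < delta) ->
      `|power_series c exponents x| <= eta /\
      defect a x (power_series c exponents x) = 0.
Proof.
move=> nf N0 Nlam tN eta eta0.
have r0 : 0 < r by case: nf.
set F := power_series c exponents.
have csum := normal_form_summable nf.
(* The normal form makes the constant coefficient equal to [quad_coef] at the zero index, which is
   0. *)
have [K1 FK] : exists K : R, forall (delta : R) x, 0 <= delta <= r / 2 ->
    (forall j, `|x 0 j| <= delta) -> `|F x| <= delta * K.
  apply: power_series_near0 => // b /mdeg_exponents_eq0 ->.
  by case: nf => _ _ ->.
have vfb k := vfield_bound (N k).
have {vfb} [K K0 vK] : exists2 K : R, 0 <= K & forall k p (rho : R),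
    (forall j, `|base p 0 j| <= rho) -> `|height p| <= rho ->
    forall j, `|base (vfield (N k) p) 0 j - base (vfield (N k) 0) 0 j| <= K * rho.
  pose Kk k := s2val (cid2 (vfb k)).
  have Kk0 k : 0 <= Kk k by exact: s2valP (cid2 (vfb k)).
  exists (\sum_(k < 5) Kk k) => [|k p rho bp hp j]; first exact: sumr_ge0.
  apply: le_trans (s2valP' (cid2 (vfb k)) p rho bp hp j) _.
  rewrite ler_wpM2r//; first exact: le_trans hp.
  by rewrite (bigD1 k)//= lerDl sumr_ge0.
pose L := \sum_(k < 5) `|lam k|.
have L0 : 0 <= L by exact: sumr_ge0.
pose H := `|K1| + 1.
have H0 : 0 < H by rewrite ltr_wpDl.
(* The four bounds serve, in order, to stay inside the domain of convergence, to get [|F| <= eta],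
   to keep the projected fields within [1 / 10] of the coordinate fields, and to get
   [2 * L * delta <= 1 / 2]. *)
have [|delta delta0 /and5P[dr deta dK dL _]] := @common_lower_bound
  [:: r / 2; eta / H; 1 / (10 * (K + 1) * (H + 1)); 1 / (4 * (L + 1))].
  by rewrite /= !divr_gt0 ?mulr_gt0//; lra.
exists delta => [|x0 x0d].
  by rewrite delta0 (le_trans dr)//; lra.
have dK' : delta * (10 * (K + 1) * (H + 1)) <= 1.
  by rewrite -ler_pdivlMr// !mulr_gt0//; lra.
have dL' : delta * (4 * (L + 1)) <= 1.
  by rewrite -ler_pdivlMr// !mulr_gt0//; lra.
have FH x : (forall j, `|x 0 j| < delta) -> `|F x| <= delta * H.
  move=> xd; apply: le_trans (_ : delta * K1 <= _).
    by apply: FK => [|j]; rewrite ?(ltW delta0) ?dr// ltW.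
  by rewrite ler_wpM2l ?(ltW delta0)// /H ler_wpDr// ler_norm.
have Feta x : (forall j, `|x 0 j| < delta) -> `|F x| <= eta.
  by move=> xd; apply: le_trans (FH x xd) _; rewrite -ler_pdivlMr.
split; first exact: Feta.
pose g x := defect a x (F x).
(* A canonical derivative is fixed here because [grad] provides the gradient only existentially. *)
pose G x h := 'D_(1 : R) (fun t : R => g (x + t *: h)) (0 : R).
have grad x : (forall j, `|x 0 j| < delta) ->
    exists2 y : 'I_5 -> R, \sum_(k < 5) `|y k| <= 2 * L * `|g x| &
    forall h, is_derive (0 : R) (1 : R) (fun t => g (x + t *: h)) (\sum_(j < 5) h 0 j * y j).
  move=> xd; have xr j : `|x 0 j| < r by apply: lt_le_trans (xd j) _; lra.
  have [D dF] := power_series_is_derive csum r0 xr.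
  pose Z k := vfield (N k) (point_over x (F x)).
  have hZ k := tangent_gradient xr (tN k) dF.
  exists (fun j => ddefect a x (F x) (delta_mx 0 j) (D j)); last first.
    move=> h; rewrite -ddefect_sum.
    have := is_derive_defect a x h (dF h).
    by rewrite scale0r addr0.
  (* The components of the gradient solve the nearly diagonal system whose [k]-th equation says that
     the projection of [Z k] sends [g] to [lam k * g]. *)
  rewrite -mulrA /L [X in _ * X]mulr_suml.
  under [X in _ <= _ * X]eq_bigr do rewrite -normrM.
  apply: (near_identity_bound (b := fun k => base (Z k))) => k; last first.
    rewrite -ddefect_sum -hZ.
    by have := Nlam k (point_over x (F x)); rewrite /= base_over height_over.
  move=> j; have := vK k (point_over x (F x)) (delta * (H + 1)).
  have kj : (delta_mx 0 k : 'rV[R]_5) 0 j = (k == j)%:R by rewrite mxE eqxx eq_sym.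
  rewrite base_over height_over N0 => /(_ _ _ j); rewrite kj => vb.
  apply: le_trans (_ : 5%:R * (K * (delta * (H + 1))) <= _).
    rewrite ler_wpM2l//; apply: vb => [i|].
      by apply: le_trans (ltW (xd i)) _; rewrite ler_peMr ?(ltW delta0)//; lra.
    by apply: le_trans (FH x xd) _; rewrite ler_wpM2l ?(ltW delta0)//; lra.
  have : 0 <= delta * (H + 1) by rewrite mulr_ge0//; lra.
  by move: dK'; nra.
have gG x : (forall j, `|x 0 j| < delta) -> forall h,
    is_derive (0 : R) (1 : R) (fun t => g (x + t *: h)) (G x h).
  by move=> /grad[y _ yd] h; rewrite /G; have := yd h => yh; rewrite derive_val.
apply: (@vanishing_of_small_gradient _ _ g G _
  (eta + 2 * (delta + `|a| * eta) ^+ 2 + delta ^+ 2 + delta ^+ 2) gG) x0d.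
- move=> x h xd hd; have [y yS yd] := grad x xd.
  rewrite /G; have := yd h => yh; rewrite derive_val.
  apply: le_trans (ler_norm_sum _ _ _) _.
  apply: le_trans (_ : \sum_(j < 5) delta * `|y j| <= _).
    by apply: ler_sum => j _; rewrite normrM ler_wpM2r// ltW.
  rewrite -mulr_sumr; apply: le_trans (_ : delta * (2 * L * `|g x|) <= _).
    by rewrite ler_wpM2l// ltW.
  have : 0 <= `|g x| by [].
  by move: dL'; nra.
- move=> x xd; apply: defect_bound (Feta x xd) => j; exact: ltW (xd j).
- have F0 : F 0 = 0.
    have := FK 0 0; rewrite mul0r lexx /= normr_le0 => F0; apply/eqP/F0.
      by rewrite divr_ge0// ltW.
    by move=> j; rewrite mxE normr0.
  by rewrite /g F0 /defect !mxE; ring.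
Qed.

End TangentFields.

(** * The shear onto the quadric and the local equality of the two hypersurfaces *)

Section AffineEquivalence.
Set Implicit Arguments. Unset Strict Implicit.
Context {R : realType}.
Local Notation C := R[i].
Implicit Types (p q : 'rV[C]_3) (x : 'rV[R]_5) (s : C).

Definition shear s : 'M[C]_3 := 1%:M + s *: delta_mx (inord 2) (inord 0).

Lemma ord3_neq : (inord 2 == inord 0 :> 'I_3) = false.
Proof. by rewrite -val_eqE /= !inordK. Qed.

Lemma shearK s : shear s *m shear (- s) = 1%:M.
Proof.
rewrite /shear mulmxDl mul1mx mulmxDr mulmx1 -scalemxAl -scalemxAr.
rewrite mul_delta_mx_cond eq_sym ord3_neq mulr0n !scaler0 addr0.
by rewrite -addrA -scalerDl addNr scale0r addr0.
Qed.

Lemma shear_unit s : shear s \in unitmx.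
Proof. by have [] := mulmx1_unit (shearK s). Qed.

Lemma mul_shear s p j : (p *m shear s) 0 j = p 0 j + (j == inord 0)%:R * (s * w p).
Proof.
rewrite /shear mulmxDr mulmx1 -scalemxAr !mxE; congr (_ + _).
rewrite (bigD1 (inord 2))//= big1 => [|k k2]; last first.
  by rewrite mxE (negPf k2) mulr0.
by rewrite mxE eqxx /= addr0 [LHS]mulrA [LHS]mulrC.
Qed.

(** The shear enlarges coordinate differences by a factor of at most [1 + |Re s| + |Im s|], so the
    radius is divided by that number. *)
Lemma copen_shear s (V : set 'rV[C]_3) :
  copen V -> copen [set q | V (q *m shear s)].
Proof.
move=> oV q /oV[e [e0 eV]].
pose k := 1 + `|complex.Re s| + `|complex.Im s|.
have k1 : 1 <= k by rewrite /k -addrA lerDl addr_ge0.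
have k0 : 0 < k by exact: lt_le_trans k1.
exists (e / k); split=> [|q' qq']; first by rewrite divr_gt0.
apply: eV => j; rewrite !mul_shear.
have -> : q' 0 j + (j == inord 0)%:R * (s * w q') - (q 0 j + (j == inord 0)%:R * (s * w q))
   = q' 0 j - q 0 j + (j == inord 0)%:R * (s * (q' 0 (inord 2) - q 0 (inord 2))).
  by rewrite /w; ring.
have [h1 h2] := qq' j; have [h3 h4] := qq' (inord 2).
have ek : e / k <= e by rewrite ler_pdivrMr// ler_peMr ?(ltW e0).
case: (j == inord 0); last first.
  by rewrite mul0r addr0; split; apply: lt_le_trans ek.
rewrite mul1r Re_addc Im_addc Re_mulc Im_mulc.
have ekE : e = e / k + `|complex.Re s| * (e / k) + `|complex.Im s| * (e / k).
  by rewrite /k; field; rewrite gt_eqF.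
split; rewrite [X in _ < X]ekE -addrA; 
  apply: le_lt_trans (ler_normD _ _) _; apply: ltr_leD => //.
  by apply: le_trans (ler_normB _ _) _; rewrite !normrM lerD// ler_wpM2l// ltW.
by apply: le_trans (ler_normD _ _) _; rewrite !normrM lerD// ler_wpM2l// ltW.
Qed.

Definition cube (eps : R) : set 'rV[C]_3 :=
  [set p | forall k, `|complex.Re (p 0 k)| < eps /\ `|complex.Im (p 0 k)| < eps].

Lemma cube_copen eps : copen (cube eps).
Proof.
move=> p pe.
pose M := \big[Num.max/0]_(k < 3) Num.max `|complex.Re (p 0 k)| `|complex.Im (p 0 k)|.
have eps0 : 0 < eps by apply: le_lt_trans (pe 0).1.
have Meps : M < eps.
  by apply/bigmax_ltP; split=> // k _; have [h1 h2] := pe k; rewrite gt_max h1.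
have pM k : `|complex.Re (p 0 k)| <= M /\ `|complex.Im (p 0 k)| <= M.
  have : Num.max `|complex.Re (p 0 k)| `|complex.Im (p 0 k)| <= M by exact: le_bigmax.
  by rewrite ge_max => /andP[].
exists (eps - M); split=> [|q pq k]; first by rewrite subr_gt0.
have [h1 h2] := pM k; have [h3 h4] := pq k.
have -> : q 0 k = p 0 k + (q 0 k - p 0 k) by rewrite addrCA subrr addr0.
rewrite Re_addc Im_addc; split; apply: le_lt_trans (ler_normD _ _) _; lra.
Qed.

Lemma cube_base eps p : cube eps p ->
  (forall j, `|base p 0 j| < eps) /\ `|height p| < eps.
Proof.
move=> pe; split; last exact: (pe _).2.
move=> j; rewrite mxE.
case: j => [[|[|[|[|[|//]]]]] jl] /=; first exact: (pe _).1.
- exact: (pe _).2.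
- exact: (pe _).1.
- exact: (pe _).2.
- exact: (pe _).1.
Qed.

Lemma defect_base a p : defect a (base p) (height p) =
  height p - 2 * (complex.Re (z1 p) + a * height p) ^+ 2
    - complex.Re (z2 p) ^+ 2 - complex.Im (z2 p) ^+ 2.
Proof. by rewrite /defect !mxE !inordK. Qed.

(** With [s = - i a] one has [Re (z1 + s w) = x1 + a v], while [z2] and [w] are unchanged. *)
Lemma quadric_shear a p :
  quadric (p *m shear (Complex 0 (- a))) <-> defect a (base p) (height p) = 0.
Proof.
rewrite defect_base /quadric /= /z1 /z2 /w !mul_shear !eqxx ord3_neq.
have -> : (inord 1 == inord 0 :> 'I_3) = false by rewrite -val_eqE /= !inordK.
rewrite !mul0r !addr0 mul1r Re_addc Re_mulc /= mul0r sub0r mulNr opprK /height /w.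
by split => H; [rewrite {1}H|]; lra.
Qed.

(** The defect is quadratic in [v] and may have a second root, away from the origin. The difference
    of two values has the factor [v - v'], and smallness makes the cofactor nonzero. *)
Lemma defect_inj a x (v v' : R) :
  2 * `|a| * (2 * `|x 0 (inord 0)| + `|a| * (`|v| + `|v'|)) < 1 ->
  defect a x v = 0 -> defect a x v' = 0 -> v = v'.
Proof.
move=> small dv dv'; apply/eqP; rewrite -subr_eq0; apply/negPn/negP => vv'.
pose y := x 0 (inord 0).
have E : (v - v') * (1 - 2 * a * (2 * y + a * (v + v'))) = 0.
  transitivity (defect a x v - defect a x v'); first by rewrite /defect /y; ring.
  by rewrite dv dv' subrr.
have : 1 - 2 * a * (2 * y + a * (v + v')) = 0.
  by move/eqP: E; rewrite mulf_eq0 (negPf vv') => /eqP.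
move=> E1; have : `|2 * a * (2 * y + a * (v + v'))| < 1.
  apply: le_lt_trans small; rewrite !normrM normr_nat ler_wpM2l//.
  apply: le_trans (ler_normD _ _) _; rewrite !normrM normr_nat lerD// ler_wpM2l//.
  exact: ler_normD.
have -> : 2 * a * (2 * y + a * (v + v')) = 1 by apply/eqP; rewrite eq_sym -subr_eq0 E1.
by rewrite normr1 ltxx.
Qed.

Lemma affinely_equiv_of_defect (r : R) (c : midx -> R) a :
  (forall eta : R, 0 < eta -> exists2 delta, 0 < delta <= r &
    forall x, (forall j, `|x 0 j| < delta) ->
      `|power_series c exponents x| <= eta /\
      defect a x (power_series c exponents x) = 0) ->
  affinely_equiv_quadric (hyps r c).
Proof.
pose A := `|a| + 1; have A1 : 1 <= A by rewrite lerDr.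
(* With this choice the quantity in [defect_inj] is at most
   [4 A eta + 4 A^2 eta <= 8 A^2 eta = 1 / 2]. *)
pose eta := 1 / (16 * A ^+ 2).
have A2 : 1 <= A ^+ 2 by rewrite expr_ge1// (le_trans _ A1).
have eta0 : 0 < eta by rewrite divr_gt0//; lra.
move=> /(_ eta eta0)[delta /andP[delta0 deltar] dF].
pose eps := Num.min delta eta.
have eps0 : 0 < eps by rewrite lt_min delta0.
(* Points of the graph have zero defect by assumption. Conversely, uniqueness of the small root puts
   a point of zero defect on the graph. *)
have MV p : cube eps p -> (hyps r c p <-> defect a (base p) (height p) = 0).
  move=> /cube_base[bp hp].
  have bd j : `|base p 0 j| < delta by apply: lt_le_trans (bp j) _; rewrite ge_min lexx.
  have [Feta dF0] := dF (base p) bd.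
  split=> [[_]|dp]; first by rewrite Fval_base /height => ->.
  split; first by apply/in_box_base => j; exact: lt_le_trans (bd j) deltar.
  rewrite Fval_base; apply: defect_inj dp dF0.
  have hx : `|base p 0 (inord 0)| <= eta.
    by apply: le_trans (ltW (bp _)) _; rewrite ge_min lexx orbT.
  have hv : `|height p| <= eta.
    by apply: le_trans (ltW hp) _; rewrite ge_min lexx orbT.
  have etaA : eta * (16 * A ^+ 2) = 1 by rewrite /eta divfK// gt_eqF//; lra.
  have aA : `|a| <= A by rewrite lerDl.
  apply: le_lt_trans (_ : 2 * A * (2 * eta + A * (eta + eta)) < 1).
    have le2 : `|a| * (`|height p| + `|power_series c exponents (base p)|) <=
        A * (eta + eta) by rewrite ler_pM ?addr_ge0// lerD.
    have le1 : 2 * `|base p 0 (inord 0)| <= 2 * eta by rewrite ler_wpM2l.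
    by rewrite ler_pM ?addr_ge0 ?mulr_ge0 ?addr_ge0 ?lerD ?ler_wpM2l.
  have : A * eta <= A ^+ 2 * eta.
    by rewrite ler_wpM2r ?(ltW eta0)// expr2 ler_peMr// (le_trans _ A1).
  by move: etaA; rewrite expr2; nra.
exists (shear (Complex 0 (- a))), 0; split; first exact: shear_unit.
(* The second set is the image of the cube under the shear, written as a preimage under the inverse
   shear. *)
exists (cube eps), [set q | cube eps (q *m shear (- Complex 0 (- a)))].
split; first exact: cube_copen.
- by move=> k; rewrite mxE /= normr0.
- exact/copen_shear/cube_copen.
apply/seteqP; split=> [_ [p [Mp Vp] <-]|q [Qq Vq]].
  rewrite addr0; split; first by apply/quadric_shear/(MV p Vp).
  by rewrite /= -mulmxA shearK mulmx1.
have sK : shear (- Complex 0 (- a)) *m shear (Complex 0 (- a)) = 1%:M.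
  by have := shearK (- Complex 0 (- a)); rewrite opprK.
exists (q *m shear (- Complex 0 (- a))).
  split=> //; apply/(MV _ Vq); apply/quadric_shear.
  by rewrite -mulmxA sK mulmx1.
by rewrite addr0 -mulmxA sK mulmx1.
Qed.

End AffineEquivalence.

(** * Verification of the eigenfunction identity for the three families *)

Section Families.
Set Implicit Arguments. Unset Strict Implicit.
Context {R : realType}.
Local Notation C := R[i].
Implicit Types (p q : 'rV[C]_3).

Lemma vfield_mx4 (a1 a2 a3 b1 b2 b3 c1 c2 c3 t1 t2 t3 : C) l p :
  vfield (mx4 [:: [:: a1; a2; a3; t1]; [:: b1; b2; b3; t2];
                  [:: c1; c2; c3; t3]; l]) p =
  \row_j nth 0 [:: a1 * z1 p + a2 * z2 p + a3 * w p + t1;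
                   b1 * z1 p + b2 * z2 p + b3 * w p + t2;
                   c1 * z1 p + c2 * z2 p + c3 * w p + t3] j.
Proof.
have o0 : p 0 ord0 = z1 p by congr (p _ _); apply/val_inj; rewrite /= inordK.
have o1 : p 0 (lift ord0 ord0) = z2 p.
  by congr (p _ _); apply/val_inj; rewrite /= inordK.
have o2 : p 0 (lift ord0 (lift ord0 ord0)) = w p.
  by congr (p _ _); apply/val_inj; rewrite /= inordK.
apply/rowP => j; rewrite !mxE !big_ord_recl big_ord0 addr0 !mxE.
rewrite !inordK ?(leqW (ltn_ord j))//.
by case: j => [[|[|[|//]]] jl]; rewrite /= ?inordK//= o0 o1 o2 addrA.
Qed.

Lemma base_row3 (a b d : C) : base (\row_j nth 0 [:: a; b; d] j) =
  row5 [:: complex.Re a; complex.Im a; complex.Re b; complex.Im b; complex.Re d].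
Proof. by rewrite /base /z1 /z2 /w !mxE !inordK. Qed.

Lemma height_row3 (a b d : C) : height (\row_j nth 0 [:: a; b; d] j) = complex.Im d.
Proof. by rewrite /height /w !mxE !inordK. Qed.

Definition adapted (a lam : R) (k : 'I_5) (N : 'M[C]_4) :=
  base (vfield N 0) = delta_mx 0 k /\
  forall p, ddefect a (base p) (height p) (base (vfield N p)) (height (vfield N p)) =
     lam * defect a (base p) (height p).

(** Reduces both conditions to the translation column and a polynomial identity in six real
    variables, which [field] can decide for each matrix. *)
Lemma adapted_mx4 (a lam : R) (k : 'I_5) (a1 a2 a3 b1 b2 b3 c1 c2 c3 t1 t2 t3 : C) l :
  [:: complex.Re t1; complex.Im t1; complex.Re t2; complex.Im t2; complex.Re t3] =
    mkseq (fun j => (j == k)%:R) 5 ->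
  (forall x1 y1 x2 y2 u v : R,
     let Z1 := a1 * Complex x1 y1 + a2 * Complex x2 y2 + a3 * Complex u v + t1 in
     let Z2 := b1 * Complex x1 y1 + b2 * Complex x2 y2 + b3 * Complex u v + t2 in
     let Z3 := c1 * Complex x1 y1 + c2 * Complex x2 y2 + c3 * Complex u v + t3 in
     complex.Im Z3 - 4 * (x1 + a * v) * (complex.Re Z1 + a * complex.Im Z3)
       - 2 * x2 * complex.Re Z2 - 2 * y2 * complex.Im Z2 =
     lam * (v - 2 * (x1 + a * v) ^+ 2 - x2 ^+ 2 - y2 ^+ 2)) ->
  adapted a lam k (mx4 [:: [:: a1; a2; a3; t1]; [:: b1; b2; b3; t2];
                  [:: c1; c2; c3; t3]; l]).
Proof.
move=> tk Zlam; split=> [|p]; rewrite vfield_mx4 base_row3.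
  rewrite /z1 /z2 /w !mxE !mulr0 !add0r tk.
  by apply/rowP => j; rewrite !mxE nth_mkseq.
rewrite height_row3 defect_base /ddefect !mxE !inordK//= /height.
case: (z1 p) => x1 y1; case: (z2 p) => x2 y2; case: (w p) => u v.
exact: Zlam.
Qed.

Lemma real_complexV (x : R) : ((x%:C)%C : C)^-1 = ((x^-1)%:C)%C.
Proof. by rewrite fmorphV. Qed.

(** Here no shear is required: the diagonal parts are dilations of weights [(1, 1, 2)] combined with
    rotations of [z2], and each eigenvalue is twice the dilation factor. *)
Lemma familyA_adapted (m1 m2 t16 : R) (k : 'I_5) : m2 != 0 ->
  adapted 0 (nth 0 [:: 2 * m1; 2 * m2; 0; 0; 0] k) k (nth 0 (familyA m1 m2 t16) k).
Proof.
move=> m20; case: k => [[|[|[|[|[|//]]]]] kl]; apply: adapted_mx4 => [//|*];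
  by rewrite ?real_complexV ?expr2 /=; field.
Qed.

(** In the coordinate [z1 - i a w], a dilation of weights [(1, 1, 2)] has first component
    proportional to [z1 + i a w]; the first rows of the third and fourth matrices then give
    [a = m1 / 2]. *)
Lemma familyB_adapted (m1 m3 m4 : R) (k : 'I_5) :
  adapted (m1 / 2) (nth 0 [:: 0; 0; 2 * m3; 2 * m4; 0] k) k (nth 0 (familyB m1 m3 m4) k).
Proof.
case: k => [[|[|[|[|[|//]]]]] kl]; apply: adapted_mx4 => [//|*];
  by rewrite ?real_complexV ?expr2 /=; field.
Qed.

(** The dilation terms [z1 + i a w] in the first rows give [a = (m1 - t7) / 2]. After the shear, the
    first matrix has dilation factor [t7] and the last one [- m2 * (m1 - t7) / 2], whence the
    eigenvalues. *)
Lemma familyC_adapted (m1 m2 m3 m4 t7 : R) (k : 'I_5) :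
  adapted ((m1 - t7) / 2) (nth 0 [:: 2 * t7; 2 * m2; 2 * m3; 2 * m4; - m2 * (m1 - t7)] k) k
    (nth 0 (familyC m1 m2 m3 m4 t7) k).
Proof.
case: k => [[|[|[|[|[|//]]]]] kl]; apply: adapted_mx4 => [//|*];
  by rewrite ?real_complexV ?expr2 /=; field.
Qed.

Lemma real_span_nth (s : seq 'M[C]_4) k : (k < size s)%N -> real_span s (nth 0 s k).
Proof.
move=> ks; exists (fun i => (i == k)%:R).
rewrite (bigD1 (Ordinal ks))//= eqxx scale1r big1 ?addr0// => i ik.
have -> : (i == k :> nat) = false by apply/negbTE; move: ik; rewrite -val_eqE.
exact: scale0r.
Qed.

Lemma adapted_equiv (s : seq 'M[C]_4) a (lam : 'I_5 -> R) (r : R) (c : midx -> R) :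
  size s = 5%N -> (forall k, adapted a (lam k) k (nth 0 s k)) ->
  integral_variety_12 s r c -> affinely_equiv_quadric (hyps r c).
Proof.
move=> s5 sa [nf ts].
apply: (@affinely_equiv_of_defect R r c a).
apply: (@defect_vanishes R r c a (fun k => nth 0 s k) lam nf).
- by move=> k; have [] := sa k.
- by move=> k p; have [_] := sa k; apply.
- by move=> k; apply/ts/real_span_nth; rewrite s5.
Qed.

End Families.

Theorem theorem4p1 (R : realType) (s : seq 'M[R[i]]_4) :
  ((exists m1 m2 t16 : R, m2 != 0 /\ s = familyA m1 m2 t16) \/
   (exists m1 m3 m4 : R, s = familyB m1 m3 m4) \/
   (exists m1 m2 m3 m4 t7 : R, s = familyC m1 m2 m3 m4 t7)) ->
  forall (r : R) (c : midx -> R),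
    integral_variety_12 s r c -> affinely_equiv_quadric (hyps r c).
Proof.
move=> [[m1 [m2 [t16 [m20 ->]]]]|[[m1 [m3 [m4 ->]]]|[m1 [m2 [m3 [m4 [t7 ->]]]]]]] r c.
- by apply: adapted_equiv => // k; exact: familyA_adapted.
- by apply: adapted_equiv => // k; exact: familyB_adapted.
- by apply: adapted_equiv => // k; exact: familyC_adapted.
Qed.
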